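(* Assume the following statement (P) holds: for all $N,M\ge1$, all domains $D\subset\mathbb{C}^N$, $G\subset\mathbb{C}^M$, and every family $\mathcal{U}$ of (not necessarily continuous) plurisubharmonic functions on $D\times G$ such that $\mathcal{U}$ is locally uniformly bounded above on $D\times\{w\}$ for each $w\in G$ and on $\{z\}\times G$ for each $z\in D$, the family $\mathcal{U}$ is locally uniformly bounded above on $D\times G$. Let $\Omega$ be an open subset of $\mathbb{C}^N$ and let $u:\Omega\to[-\infty,\infty)$ be a function such that $u|_{\Omega\cap L}$ is subharmonic for each complex line $L$. Define \[ s(z):=\sup\{v(z): v\text{ plurisubharmonic on }\Omega,\ v\le u\}. \] Then $s$ is plurisubharmonic on $\Omega$.
   Context: A domain is a connected open set. A function $u:\Omega\to[-\infty,\infty)$ on an open set $\Omega\subset\mathbb{C}^N$ is plurisubharmonic if it is upper semicontinuous and its restriction to $\Omega\cap L$ is subharmonic for every complex line $L$. A family $\mathcal{U}$ is locally uniformly bounded above on a set $S$ if for every compact subset $C$ of $S$ there is a constant $c$ with $u\le c$ on $C$ for all $u\in\mathcal{U}$. *)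

(* Defs.v *)
From HB Require Import structures.
From mathcomp Require Import all_boot all_order all_algebra.
From mathcomp Require Import all_classical all_reals all_analysis.
Set Implicit Arguments. Unset Strict Implicit. Unset Printing Implicit Defensive.
Import Order.TTheory GRing.Theory Num.Theory.
Import numFieldNormedType.Exports.
Local Open Scope classical_set_scope.
Local Open Scope ring_scope.

(* The complex plane C is modelled as R * R (real part, imaginary part).
   C^n is modelled as 'rV[R]_n * 'rV[R]_n (real parts, imaginary parts),
   with its product topology (= the Euclidean topology of C^n). *)
Definition Cn (R : realType) (n : nat) := ('rV[R]_n * 'rV[R]_n)%type.

(* the point a + lam * b (complex scalar lam) of the complex line through a
   with direction b *)
Definition cline (R : realType) (n : nat) (a b : Cn R n) (lam : R * R) : Cn R n :=
  (a.1 + lam.1 *: b.1 - lam.2 *: b.2, a.2 + lam.1 *: b.2 + lam.2 *: b.1).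

Definition usc_at (R : realType) (T : topologicalType) (f : T -> \bar R) (x : T) :=
  forall c : R, (f x < c%:E)%E -> \forall y \near x, (f y < c%:E)%E.

Definition cdisk (R : realType) (a : R * R) (r : R) : set (R * R) :=
  [set z | (z.1 - a.1) ^+ 2 + (z.2 - a.2) ^+ 2 <= r ^+ 2].

Definition subharmonic (R : realType) (V : set (R * R)) (f : R * R -> \bar R) :=
  [/\ open V,
      (forall x, V x -> (f x < +oo)%E),
      (forall x, V x -> usc_at f x) &
      (forall (a : R * R) (r : R), V a -> 0 < r -> cdisk a r `<=` V ->
        ((2 * pi)%:E * f a <=
          \int[lebesgue_measure]_(t in `[0%R, (2 * pi)%R])
             f (a.1 + r * cos t, a.2 + r * sin t)%R)%E)].

Definition psh (R : realType) (n : nat) (O : set (Cn R n)) (f : Cn R n -> \bar R) :=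
  [/\ open O,
      (forall x, O x -> (f x < +oo)%E),
      (forall x, O x -> usc_at f x) &
      (forall a b : Cn R n, b != 0 ->
         subharmonic [set lam | O (cline a b lam)] (f \o cline a b))].

Definition domain (R : realType) (n : nat) (D : set (Cn R n)) :=
  open D /\ connected D.

Definition loc_unif_bdd_above (R : realType) (T : topologicalType)
    (U : set (T -> \bar R)) (S : set T) :=
  forall C : set T, compact C -> C `<=` S ->
    exists c : R, forall v x, U v -> C x -> (v x <= c%:E)%E.

Definition cjoin (R : realType) (N M : nat) (z : Cn R N) (w : Cn R M) : Cn R (N + M) :=
  (row_mx z.1 w.1, row_mx z.2 w.2).

Definition cprod (R : realType) (N M : nat) (D : set (Cn R N)) (G : set (Cn R M)) :
    set (Cn R (N + M)) :=
  [set p | exists z w, [/\ D z, G w & p = cjoin z w]].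

Definition statementP (R : realType) :=
  forall (N M : nat), (1 <= N)%N -> (1 <= M)%N ->
  forall (D : set (Cn R N)) (G : set (Cn R M)) (U : set (Cn R (N + M) -> \bar R)),
    domain D -> domain G ->
    (forall v, U v -> psh (cprod D G) v) ->
    (forall w, G w -> loc_unif_bdd_above U (cprod D [set w])) ->
    (forall z, D z -> loc_unif_bdd_above U (cprod [set z] G)) ->
    loc_unif_bdd_above U (cprod D G).

Definition psh_envelope (R : realType) (n : nat) (O : set (Cn R n))
    (u : Cn R n -> \bar R) : Cn R n -> \bar R :=
  fun z => ereal_sup [set v z | v in [set v | psh O v /\ forall x, O x -> (v x <= u x)%E]].

(* Main.v *)
Require Import Defs.
From HB Require Import structures.
From mathcomp Require Import all_boot all_order all_algebra.
From mathcomp Require Import all_classical all_reals all_analysis.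
From mathcomp Require Import measurable_realfun ring lra.
Import Order.TTheory GRing.Theory Num.Theory.
Import numFieldNormedType.Exports.
Local Open Scope classical_set_scope.
Local Open Scope ring_scope.

Set Implicit Arguments. Unset Strict Implicit. Unset Printing Implicit Defensive.

(** Let s be the envelope and s* its upper semicontinuous regularization. It is
    enough that s* is plurisubharmonic and s* <= u, since then s* is one of the
    minorants defining s.

    Along every complex line u is upper semicontinuous, so the minorants of u
    are uniformly bounded on compact subsets of lines; statement (P), applied
    with one factor C and by induction on the dimension, makes them locally
    uniformly bounded. Hence s* < +oo, and the sub-mean value inequality for s*
    follows from Fatou's lemma applied to minorants v_k with v_k(y_k) close to
    s*(p), y_k -> p.

    For s* <= u (u is not semicontinuous in all variables jointly) one shows:
    if plurisubharmonic v_k <= u are locally uniformly bounded above and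
    y_k -> p, then limsup v_k(y_k) <= u(p). In dimension 1 + N write
    y_k = (a_k, b_k) and average over a disk of the first variable:
      C - v_k(y_k) >= mean of C - v_k(x, b_k) over the disk centred at a_k.
    By induction liminf (C - v_k(x, b_k)) >= C - u(x, p_2) for each fixed x, so
    Fatou's lemma bounds the left-hand side from below by the mean of
    C - u(x, p_2) over a disk centred at p_1, which is nearly C - u(p) by
    semicontinuity of u on the line. *)

(** * Rotation invariance of the plane Lebesgue integral *)

Section plane.
Context {R : realType}.
Local Notation mu := (@lebesgue_measure R).
Local Notation RR := (measurableTypeR R * measurableTypeR R)%type.
Local Notation mu2 := (@lebesgue_measure R \x @lebesgue_measure R)%E.
Implicit Types (g : RR -> \bar R) (f : R -> \bar R).

(** The pushforward of Lebesgue measure under a translation has the same values on half-open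
    intervals, and these determine the measure. *)
Lemma ge0_integral_addr f (c : R) : measurable_fun setT f ->
  (forall x, 0 <= f x)%E ->
  (\int[mu]_x f (x + c)%R = \int[mu]_x f x)%E.
Proof.
move=> mf f0.
pose h := (fun x : R => x + c) : measurableTypeR R -> measurableTypeR R.
have mh : measurable_fun setT h by exact: measurable_funD.
transitivity (\int[pushforward mu h]_x f x)%E.
  by rewrite ge0_integral_pushforward.
apply: eq_measure_integral => A mA _; apply/esym/lebesgue_measure_unique => //.
move=> _ [[a b]] _ <- /=; rewrite /pushforward.
have -> : h @^-1` [set` `]a, b]] = [set` `]a - c, b - c]].
  by apply/seteqP; split => x /=; rewrite !in_itv/= /h ltrBlDr lerBrDr.
rewrite !lebesgue_measure_itv/= !lte_fin ltrD2r.
by case: ifP => // _; rewrite -!EFinD; congr EFin; ring.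
Qed.

(** Measurability is meant in the product sigma-algebra: an open set is the countable union of the
    squares with rational centre and half-side that it contains. *)
Lemma open_measurable2 (A : set (R * R)) : open A -> measurable (A : set RR).
Proof.
move=> oA.
pose box (q : rat * (rat * rat)) : set RR :=
  [set x : R | ball (ratr q.1 : R) (ratr q.2.2) x] `*`
  [set y : R | ball (ratr q.2.1 : R) (ratr q.2.2) y].
pose S := [set q | box q `<=` A].
have -> : (A : set RR) = \bigcup_(q in S) box q.
  apply/seteqP; split=> [z Az|z [q Sq bz]]; last exact: Sq.
  have /nbhs_ballP[e /= e0 eA] : nbhs z A by move: oA; rewrite openE => /(_ _ Az).
  (* A square of half-side r < e / 2 whose centre is within r of [z] stays within e of [z]. *)
  have [r] : exists r : rat, ratr r \in `]0, e / 2[%R.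
    by apply: rat_in_itvoo; rewrite divr_gt0.
  rewrite in_itv /= => /andP[r0 re].
  have app (x : R) : exists q : rat, ball (ratr q : R) (ratr r) x.
    have [q] : exists q : rat, ratr q \in `]x - ratr r, x + ratr r[%R.
      by apply: rat_in_itvoo; rewrite ltrD2l gtrN.
    rewrite in_itv /= => /andP[h1 h2]; exists q; rewrite /ball /= ltr_distlC.
    by rewrite ltrBlDr h2 -ltrBlDr h1.
  have [q1 h1] := app z.1; have [q2 h2] := app z.2.
  exists (q1, (q2, r)) => //.
  move=> y [/= y1 y2]; apply: eA; split.
    rewrite [e]splitr; apply: ball_triangle (le_ball (ltW re) y1).
    exact/ball_sym/(le_ball (ltW re)).
  rewrite [e]splitr; apply: ball_triangle (le_ball (ltW re) y2).
  exact/ball_sym/(le_ball (ltW re)).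
rewrite bigcup_mkcond; apply: countable_bigcupT_measurable => // q.
case: ifP => // _; by apply: measurableX; apply: open_measurable; apply: ball_open.
Qed.

(** By Tonelli, integrating first in the variable that moves: on each slice the shear is a
    translation. *)
Lemma ge0_integral_shearl g (h : R -> R) : measurable_fun setT g ->
  (forall x, 0 <= g x)%E -> measurable_fun setT h ->
  (\int[mu2]_x g (x.1 + h x.2, x.2)%R = \int[mu2]_x g x)%E.
Proof.
move=> mg g0 mh.
rewrite !fubini_tonelli2 //; last first.
  apply: (measurableT_comp mg); apply: measurable_fun_pair => //=.
  apply: measurable_funD => //.
  exact: (measurableT_comp mh).
apply: eq_integral => y _; rewrite /fubini_G /=.
apply: (ge0_integral_addr (f := fun x => g (x, y))) => // .
exact: measurableT_comp.
Qed.

Lemma ge0_integral_shearr g (h : R -> R) : measurable_fun setT g ->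
  (forall x, 0 <= g x)%E -> measurable_fun setT h ->
  (\int[mu2]_x g (x.1, x.2 + h x.1)%R = \int[mu2]_x g x)%E.
Proof.
move=> mg g0 mh.
rewrite !fubini_tonelli1 //; last first.
  apply: (measurableT_comp mg); apply: measurable_fun_pair => //=.
  apply: measurable_funD => //.
  exact: (measurableT_comp mh).
apply: eq_integral => y _; rewrite /fubini_F /=.
apply: (ge0_integral_addr (f := fun x => g (y, x))) => // .
exact: measurableT_comp.
Qed.

Lemma ge0_integral_add2 g (a : RR) : measurable_fun setT g ->
  (forall x, 0 <= g x)%E ->
  (\int[mu2]_x g (x.1 + a.1, x.2 + a.2)%R = \int[mu2]_x g x)%E.
Proof.
move=> mg g0.
rewrite -[RHS](ge0_integral_shearl (h := cst a.1)) //.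
rewrite -[RHS](ge0_integral_shearr (h := cst a.2)) //.
apply: (measurableT_comp mg); apply: measurable_fun_pair => //=.
exact: measurable_funD.
Qed.

Definition cmul (x y : R * R) : R * R :=
  (x.1 * y.1 - x.2 * y.2, x.1 * y.2 + x.2 * y.1).

Lemma measurable_cmul (x : R * R) :
  measurable_fun setT (cmul x : RR -> RR).
Proof.
apply: measurable_fun_pair; first by apply: measurable_funB; exact: measurable_funM.
by apply: measurable_funD; exact: measurable_funM.
Qed.

(* For x.2 != 0 the rotation by x is a product of three shears. *)
Lemma ge0_integral_rotation g (x : R * R) : x.1 ^+ 2 + x.2 ^+ 2 = 1 ->
  measurable_fun setT g -> (forall y, 0 <= g y)%E ->
  (\int[mu2]_y g (cmul x y) = \int[mu2]_y g y)%E.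
Proof.
wlog x20 : x g / x.2 != 0 => [H x1 mg g0|].
  (* A real x is the product of i and - x i, both of modulus one with nonzero imaginary part. *)
  have [x20|] := eqVneq x.2 0; last by move=> /H; exact.
  have E y : cmul x y = cmul (0, 1) (cmul (0, - x.1) y).
    by rewrite /cmul /= x20; congr pair; ring.
  under eq_integral do rewrite E.
  rewrite (H (0, - x.1) (fun y => g (cmul (0, 1) y)))//=.
  - by rewrite H//= ?oner_eq0// expr0n expr1n add0r.
  - rewrite oppr_eq0; apply: contra_eq_neq x1 => ->.
    by rewrite x20 expr0n addr0 eq_sym oner_eq0.
  - by rewrite -x1 x20 sqrrN; ring.
  - exact: measurableT_comp mg (measurable_cmul _).
(* For x = (cos t, sin t) this is - tan (t / 2), the coefficient of the two outer shears; the middle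
   one has coefficient sin t. *)
move=> x1 mg g0; pose a := (x.1 - 1) / x.2.
have E y : cmul x y = ((y.1 + a * y.2) + a * (y.2 + x.2 * (y.1 + a * y.2)),
    y.2 + x.2 * (y.1 + a * y.2)).
  rewrite /cmul /a; congr pair; last by field.
  transitivity (x.1 * y.1 + (x.1 ^+ 2 - 1) / x.2 * y.2); last by field.
  have -> : x.1 ^+ 2 - 1 = - x.2 ^+ 2 by rewrite -x1; ring.
  by field.
pose g1 z : \bar R := g (z.1 + a * z.2, z.2).
have mg1 : measurable_fun setT g1.
  apply: (measurableT_comp mg); apply: measurable_fun_pair => //=.
  by apply: measurable_funD => //; apply: measurable_funM.
pose g2 z : \bar R := g1 (z.1, z.2 + x.2 * z.1).
have mg2 : measurable_fun setT g2.
  apply: (measurableT_comp mg1); apply: measurable_fun_pair => //=.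
  by apply: measurable_funD => //; apply: measurable_funM.
transitivity (\int[mu2]_y g2 (y.1 + a * y.2, y.2)%R)%E.
  by apply: eq_integral => y _; rewrite E.
have ml (c : R) : measurable_fun setT ( *%R c) by exact: measurable_funM.
have := ge0_integral_shearl mg2 (fun z => g0 _) (ml a).
have := ge0_integral_shearr mg1 (fun z => g0 _) (ml x.2).
have := ge0_integral_shearl mg g0 (ml a).
by move=> <- <- <-.
Qed.

End plane.

(** * Semicontinuity, measurability, and integrals of C - f *)

Lemma usc_at_comp (R : realType) (S T : topologicalType) (g : S -> T)
    (f : T -> \bar R) (x : S) :
  {for x, continuous g} -> usc_at f (g x) -> usc_at (f \o g) x.
Proof. by move=> cg uf c /uf; exact: cg. Qed.

Lemma usc_measurable (R : realType) (f : R -> \bar R) :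
  (forall x, usc_at f x) -> measurable_fun setT f.
Proof.
move=> uf; have -> : f = -%E \o (fun x => - f x)%E.
  by apply/funext => x /=; rewrite oppeK.
apply: measurableT_comp => //; apply: lower_semicontinuous_measurable.
move=> x a; rewrite lteNr => /uf Ha.
by exists [set y | f y < (- a)%:E]%E => // y /=; rewrite lteNr.
Qed.

Lemma lsc_measurable2 (R : realType) (g : R * R -> \bar R) :
  lower_semicontinuous g ->
  measurable_fun setT (g : measurableTypeR R * measurableTypeR R -> \bar R).
Proof.
move=> scif; apply: (measurability _ (ErealGenOInfty.measurableE R)).
move=> /= _ [_ [a ->]] <-; apply: measurableI => //; apply: open_measurable2.
by rewrite preimage_itvoy; move/lower_semicontinuousP : scif; exact.
Qed.

(** Trades a lower bound on the integral of [f], which may be -oo, for an upper bound on the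
    integral of the nonnegative function C - f, to which Tonelli and Fatou apply. Since f <= C, the
    positive part is integrable, so splitting into positive and negative parts never produces oo -
    oo. *)
Lemma le_integral_cstB d (T : measurableType d) (R : realType)
    (mu : {measure set T -> \bar R}) (D : set T) (m C c : R) (f : T -> \bar R) :
  measurable D -> mu D = m%:E -> 0 <= C -> measurable_fun D f ->
  (forall x, D x -> (f x <= C%:E)%E) ->
  (\int[mu]_(x in D) (C%:E - f x) <= ((C - c) * m)%:E)%E =
  ((m * c)%:E <= \int[mu]_(x in D) f x)%E.
Proof.
move=> mD Dm C0 mf fC.
have fpC x : D x -> (f^\+ x <= C%:E)%E.
  by move=> Dx; rewrite funeposE ge_max fC//= lee_fin.
have mfp : measurable_fun D f^\+%E by exact: measurable_funepos.
have mfn : measurable_fun D f^\-%E by exact: measurable_funeneg.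
have intC : mu.-integrable D (cst C%:E).
  apply/integrableP; split => //=.
  by rewrite integral_cst//= Dm -EFinM ltry.
have intp : mu.-integrable D f^\+%E.
  apply: le_integrable intC => // x Dx /=.
  by rewrite gee0_abs ?funepos_ge0// ger0_norm ?fpC.
have -> : (\int[mu]_(x in D) (C%:E - f x) =
    (C%:E * m%:E - \int[mu]_(x in D) f^\+ x) + \int[mu]_(x in D) f^\- x)%E.
  rewrite -[X in (X - _)%E](_ : \int[mu]_(x in D) cst C%:E x = _)%E; last first.
    by rewrite integral_cst// Dm.
  rewrite -integralB// -ge0_integralD//.
  - apply: eq_integral => x /[!inE] /fC; rewrite funeposE funenegE.
    case: (f x) => [r _| |_] //=.
      rewrite -!EFin_max -!EFinB -EFinD; congr EFin.
      case: (leP r 0) => r0.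
        by rewrite max_l; lra.
      by rewrite max_r; lra.
    by rewrite maxNye maxye sube0 addey.
  - by move=> x Dx; rewrite sube_ge0 ?fpC//= orbT.
  - by apply: emeasurable_funB => //.
rewrite [in RHS]integralE.
have : (\int[mu]_(x in D) f^\+ x \is a fin_num)%E by exact: integrable_fin_num.
move: (\int[mu]_(x in D) f^\+ x)%E => [p| |]// _.
have : (0 <= \int[mu]_(x in D) f^\- x)%E by exact: integral_ge0.
case: (\int[mu]_(x in D) f^\- x)%E => [q| |]//= _.
rewrite -EFinM -!EFinB -EFinD !lee_fin.
by apply/idP/idP => ?; lra.
Qed.

(** * Complex lines *)

Lemma cvg_to_pair (T : Type) (U V : topologicalType) (F : set_system T)
    (f : T -> U) (g : T -> V) (u : U) (v : V) : Filter F ->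
  f x @[x --> F] --> u -> g x @[x --> F] --> v ->
  (f x, g x) @[x --> F] --> (u, v).
Proof. by move=> FF fu gv; exact: cvg_pair fu gv. Qed.

Section lines.
Context {R : realType} {n : nat}.
Implicit Types (a b : Cn R n) (x y : R * R).

(** Here [cline 0 b y] is the vector y b, so a factor of the parameter can be moved into the
    direction of the line. *)
Lemma cline_cmul a b x y : cline a b (cmul x y) = cline a (cline 0 b y) x.
Proof. by congr pair; apply/rowP => j; rewrite !mxE /=; ring. Qed.

Lemma clineD a b x y : cline (cline a b x) b y = cline a b (x + y).
Proof. by congr pair; apply/rowP => j; rewrite !mxE /=; ring. Qed.

Lemma cline0 a b : cline a b 0 = a.
Proof.
rewrite [RHS](surjective_pairing a).
by congr pair; apply/rowP => j; rewrite !mxE /=; ring.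
Qed.

(** Multiplying y b = 0 by the conjugate of y gives |y|^2 b = 0. *)
Lemma cline_neq0 b y : b != 0 -> y != 0 -> cline 0 b y != 0.
Proof.
move=> b0; apply: contra_neq => e0.
have s0 : (y.1 ^+ 2 + y.2 ^+ 2) *: b.1 = 0 /\ (y.1 ^+ 2 + y.2 ^+ 2) *: b.2 = 0.
  move/(congr1 (fun z => cline 0 z (y.1, - y.2))) : e0.
  rewrite -cline_cmul => /pair_equal_spec[/rowP e1 /rowP e2].
  split; apply/rowP => j; first by move: (e1 j); rewrite !mxE/= => e; lra.
  by move: (e2 j); rewrite !mxE/= => e; lra.
have {s0} : y.1 ^+ 2 + y.2 ^+ 2 == 0.
  case: s0 => /eqP + /eqP; rewrite !scaler_eq0.
  case: (_ == 0) => //= /eqP b1 /eqP b2; case/eqP : b0.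
  by rewrite (surjective_pairing b) b1 b2.
rewrite paddr_eq0 ?sqr_ge0// !sqrf_eq0 => /andP[/eqP y1 /eqP y2].
by rewrite (surjective_pairing y) y1 y2.
Qed.

Lemma cline_continuous b : continuous (fun p : Cn R n * (R * R) => cline p.1 b p.2).
Proof.
move=> p.
have c1 : continuous (fun q : Cn R n * (R * R) => q.1) by move=> q; exact: cvg_fst.
have c2 : continuous (fun q : Cn R n * (R * R) => q.2) by move=> q; exact: cvg_snd.
have c11 : {for p, continuous (fun q : Cn R n * (R * R) => q.1.1)}.
  by apply: continuous_comp; [exact: c1|exact: cvg_fst].
have c12 : {for p, continuous (fun q : Cn R n * (R * R) => q.1.2)}.
  by apply: continuous_comp; [exact: c1|exact: cvg_snd].
have c21 : {for p, continuous (fun q : Cn R n * (R * R) => q.2.1)}.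
  by apply: continuous_comp; [exact: c2|exact: cvg_fst].
have c22 : {for p, continuous (fun q : Cn R n * (R * R) => q.2.2)}.
  by apply: continuous_comp; [exact: c2|exact: cvg_snd].
rewrite /continuous_at /cline; apply: cvg_to_pair => /=.
  by apply: cvgB; [apply: cvgD => //|]; apply: cvgZr_tmp.
by apply: cvgD; [apply: cvgD => //|]; apply: cvgZr_tmp.
Qed.

Lemma cline_continuousr a b : continuous (cline a b).
Proof.
move=> x; have := @cline_continuous b (a, x).
apply: (@cvg_comp _ _ _ (fun x => (a, x)) (fun p : _ * _ => cline p.1 b p.2)).
by apply: cvg_to_pair => //=; exact: cvg_cst.
Qed.

Lemma circle_continuous : continuous (fun t : R => (cos t, sin t)).
Proof.
by move=> t; apply: cvg_to_pair => /=; [exact: continuous_cos|exact: continuous_sin].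
Qed.

End lines.

(** * Sub-mean value inequalities over circles and disks *)

Definition odisk (R : realType) (r : R) : set (R * R) :=
  [set x | x.1 ^+ 2 + x.2 ^+ 2 < r ^+ 2].

Lemma sqrnorm_cmul (R : realType) (x y : R * R) :
  (cmul x y).1 ^+ 2 + (cmul x y).2 ^+ 2 =
  (x.1 ^+ 2 + x.2 ^+ 2) * (y.1 ^+ 2 + y.2 ^+ 2).
Proof. by rewrite /cmul/=; ring. Qed.

(* [fubini_tonelli] does not apply directly, because sigma-finiteness of
   [m1 \x m2] is not inferred. *)
Lemma fubini_tonelli_prod d1 d2 d3 (T1 : measurableType d1)
    (T2 : measurableType d2) (T3 : measurableType d3) (R : realType)
    (m1 : {sigma_finite_measure set T1 -> \bar R})
    (m2 : {sigma_finite_measure set T2 -> \bar R})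
    (m3 : {sigma_finite_measure set T3 -> \bar R})
    (f : T3 * (T1 * T2) -> \bar R) :
  measurable_fun setT f -> (forall z, 0 <= f z)%E ->
  (\int[m3]_z \int[m1 \x m2]_x f (z, x) =
   \int[m1 \x m2]_x \int[m3]_z f (z, x))%E.
Proof.
move=> mf f0.
have mfz z : measurable_fun setT (fun x => f (z, x)) by exact: measurableT_comp.
have mfx x : measurable_fun setT (fun p : T3 * T2 => f (p.1, (x, p.2))).
  apply: (measurableT_comp mf); apply: measurable_fun_pair => //=.
  exact: measurable_fun_pair.
have mF : measurable_fun setT (fun q : T3 * T1 => \int[m2]_y f (q.1, (q.2, y)))%E.
  apply: (@measurable_fun_fubini_tonelli_F _ _ _ _ _ m2
    (fun q : (T3 * T1) * T2 => f (q.1.1, (q.1.2, q.2)))) => //.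
  apply: (measurableT_comp mf); apply: measurable_fun_pair => //=.
    exact: measurableT_comp.
  by apply: measurable_fun_pair => //; exact: measurableT_comp.
have mG : measurable_fun setT (fun x : T1 * T2 => \int[m3]_z f (z, x))%E.
  exact: (@measurable_fun_fubini_tonelli_G _ _ _ _ _ m3 f).
transitivity (\int[m3]_z \int[m1]_x \int[m2]_y f (z, (x, y)))%E.
  by apply: eq_integral => z _; rewrite fubini_tonelli1.
rewrite (@fubini_tonelli _ _ _ _ _ m3 m1
  (fun q : T3 * T1 => \int[m2]_y f (q.1, (q.2, y)))%E)//=; last first.
  by move=> q; exact: integral_ge0.
rewrite fubini_tonelli1//; last by move=> x; exact: integral_ge0.
apply: eq_integral => x _; rewrite /fubini_F.
exact: (@fubini_tonelli _ _ _ _ _ m3 m2 (fun p => f (p.1, (x, p.2)))).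
Qed.

Section means.
Context {R : realType} {n : nat}.
Implicit Types (O : set (Cn R n)) (f : Cn R n -> \bar R) (a b : Cn R n).
Local Notation mu := (@lebesgue_measure R).
Local Notation RR := (measurableTypeR R * measurableTypeR R)%type.
Local Notation mu2 := (@lebesgue_measure R \x @lebesgue_measure R)%E.

Lemma lebesgue_measure_period : mu `[0%R, (2 * pi)%R] = (2 * pi)%:E :> \bar R.
Proof. by rewrite lebesgue_measure_itv/= lte_fin mulr_gt0 ?pi_gt0// oppr0 adde0. Qed.

(** The circle of radius r about the parameter x of a line is the unit circle of the same line with
    base point [cline a b x] and direction r b. *)
Lemma psh_of_unit_circle O f : open O -> (forall x, O x -> (f x < +oo)%E) ->
  (forall x, O x -> usc_at f x) ->
  (forall a b, b != 0 -> (forall x, cdisk 0 1 x -> O (cline a b x)) ->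
    ((2 * pi)%:E * f a <=
      \int[mu]_(t in `[0%R, (2 * pi)%R]) f (cline a b (cos t, sin t)))%E) ->
  psh O f.
Proof.
move=> oO foo uf mf; split => // a b b0; split.
- by apply: open_comp => // x _; exact: cline_continuousr.
- by move=> x; exact: foo.
- by move=> x Ox; apply: usc_at_comp; [exact: cline_continuousr|exact: uf].
- move=> x r Ox r0 dO.
  have E y : cline a b (x + cmul y (r, 0)) =
             cline (cline a b x) (cline 0 b (r, 0)) y.
    by rewrite -clineD cline_cmul.
  have := mf (cline a b x) (cline 0 b (r, 0)).
  move=> /= /(_ (cline_neq0 b0 _)) H.
  have /H {}H : (r, 0) != 0 :> R * R.
    by apply/eqP => -[] /eqP; rewrite gt_eqF.
  apply: le_trans (H _) _.
    move=> y y1; rewrite -E; apply: dO; rewrite /cdisk/=.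
    rewrite /cdisk /= !subr0 expr1n in y1.
    have -> : (x.1 + (y.1 * r - y.2 * 0) - x.1) ^+ 2 +
      (x.2 + (y.1 * 0 + y.2 * r) - x.2) ^+ 2 = (y.1 ^+ 2 + y.2 ^+ 2) * r ^+ 2.
      by ring.
    by rewrite ger_pMl// exprn_gt0.
  rewrite le_eqVlt; apply/orP; left; apply/eqP; apply: eq_integral => t _ /=; rewrite -E.
  congr (f (cline a b _)); rewrite /cmul /=; congr pair => /=.
    by rewrite mulr0 subr0 mulrC.
  by rewrite mulr0 add0r mulrC.
Qed.

Lemma circle_mean O f a b : psh O f -> b != 0 ->
  (forall x, cdisk 0 1 x -> O (cline a b x)) ->
  ((2 * pi)%:E * f a <=
     \int[mu]_(t in `[0%R, (2 * pi)%R]) f (cline a b (cos t, sin t)))%E.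
Proof.
move=> [_ _ _ /(_ a b)] + b0 dO => /(_ b0)[_ _ _ /(_ 0 1)] /= H.
rewrite -{1}(cline0 a b); apply: le_trans (H _ _ _) _ => //.
- by rewrite cline0 -(cline0 a b); apply: dO; rewrite /cdisk /= subr0; lra.
- rewrite le_eqVlt; apply/orP; left; apply/eqP; apply: eq_integral => t _ /=.
  by rewrite !add0r !mul1r.
Qed.

Lemma measurable_circle f a b (D : set R) :
  (forall t, usc_at f (cline a b (cos t, sin t))) ->
  measurable_fun D (fun t => f (cline a b (cos t, sin t))).
Proof.
move=> uf; apply: (measurable_funS measurableT) => //; apply: usc_measurable => t.
apply: (usc_at_comp (g := fun t => cline a b (cos t, sin t))); last exact: uf.
apply: (continuous_comp (f := fun t => (cos t, sin t))).
  exact: circle_continuous.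
exact: cline_continuousr.
Qed.

Lemma circle_in_cdisk (t : R) : cdisk 0 1 (cos t, sin t).
Proof. by rewrite /cdisk /= !subr0 cos2Dsin2 expr1n. Qed.

Lemma circle_mean_cstB O f a b (C c : R) : psh O f -> b != 0 -> 0 <= C ->
  (forall x, cdisk 0 1 x -> O (cline a b x) /\ (f (cline a b x) <= C%:E)%E) ->
  (c%:E <= f a)%E ->
  (\int[mu]_(t in `[0%R, (2 * pi)%R]) (C%:E - f (cline a b (cos t, sin t)))
    <= ((C - c) * (2 * pi))%:E)%E.
Proof.
move=> pf b0 C0 dO cf; rewrite le_integral_cstB//=.
- rewrite EFinM; apply: le_trans (circle_mean pf b0 _) => [|x /dO[]//].
  by rewrite lee_pmul2l// lte_fin mulr_gt0// pi_gt0.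
- exact: lebesgue_measure_period.
- apply: measurable_circle => t; case: pf => _ _ + _; apply.
  by case: (dO _ (circle_in_cdisk t)).
- by move=> t _; case: (dO _ (circle_in_cdisk t)).
Qed.

Lemma lt_cstB (C r : R) (x : \bar R) : (r%:E < C%:E - x)%E = (x < (C - r)%:E)%E.
Proof.
case: x => [x| |] //=; last by rewrite addey// ltry ltNyr.
by rewrite -EFinB !lte_fin; apply/idP/idP => ?; lra.
Qed.

(** As C - f >= 0 and [D] is open, extension by 0 keeps lower semicontinuity; this gives
    measurability on the whole plane with no information on [f] off [D]. *)
Lemma lsc_cstB_patch (T : topologicalType) (D : set T) (f : T -> \bar R) (C : R) :
  open D -> (forall x, D x -> usc_at f x) ->
  (forall x, D x -> (f x <= C%:E)%E) ->
  lower_semicontinuous ((fun x => C%:E - f x)%E \_ D).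
Proof.
move=> oD uf fC x r; rewrite patchE.
have ge0 y : (0 <= ((fun x => C%:E - f x)%E \_ D) y)%E.
  by rewrite patchE; case: ifPn => //; rewrite inE => Dy; rewrite sube_ge0 ?fC//= orbT.
case: ifPn => [/[!inE] Dx|_ r0]; last first.
  by exists setT; [exact: filterT|move=> y _; exact: lt_le_trans r0 (ge0 _)].
rewrite lt_cstB => /(uf _ Dx) fr.
exists (D `&` [set y | f y < (C - r)%:E]%E).
  by apply: filterI => //; exact: open_nbhs_nbhs.
by move=> y [Dy fy]; rewrite patchE mem_set//= lt_cstB.
Qed.

Lemma open_odisk (r : R) : open (odisk r).
Proof.
rewrite /odisk; have -> : [set x : R * R | x.1 ^+ 2 + x.2 ^+ 2 < r ^+ 2] =
  (fun x : R * R => x.1 ^+ 2 + x.2 ^+ 2) @^-1` [set y | y < r ^+ 2] by [].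
apply: open_comp; last exact: open_lt.
move=> x _; have c1 : {for x, continuous (fun x : R * R => x.1)} by exact: cvg_fst.
have c2 : {for x, continuous (fun x : R * R => x.2)} by exact: cvg_snd.
by apply: cvgD; rewrite expr2; under eq_fun do rewrite expr2; apply: cvgM.
Qed.

(* Averaging over rotations of the disk turns the area integral into circle
   means; the circle through [x] is parametrized starting from [x] by taking
   [x * b] as direction of the line, so that no polar coordinates occur. *)
Lemma area_mean O f a b (r C c : R) : psh O f -> b != 0 -> 0 <= C ->
  (forall x, odisk r x -> O (cline a b x) /\ (f (cline a b x) <= C%:E)%E) ->
  (c%:E <= f a)%E ->
  (\int[mu2]_x ((fun x => C%:E - f (cline a b x)) \_ (odisk r)) x
    <= (C - c)%:E * mu2 (odisk r))%E.
Proof.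
move=> pf b0 C0 dO cf.
set G := (_ \_ _)%E.
have G0 x : (0 <= G x)%E.
  rewrite /G patchE; case: ifPn => //; rewrite inE => /dO[_ fC].
  by rewrite sube_ge0 ?fC//= orbT.
have mG : measurable_fun setT (G : RR -> \bar R).
  apply: lsc_measurable2; apply: lsc_cstB_patch => //; first exact: open_odisk.
    move=> x /dO[Ox _]; apply: usc_at_comp; first exact: cline_continuousr.
    by case: pf => _ _ + _; exact.
  by move=> x /dO[].
have mB : measurable (odisk r : set RR) by apply: open_measurable2; exact: open_odisk.
pose D : set (measurableTypeR R) := `[0%R, (2 * pi)%R]%classic.
have mD : measurable D by exact: measurable_itv.
pose rot (z : measurableTypeR R * RR) : RR := cmul (cos z.1, sin z.1) z.2.
have mrot : measurable_fun setT rot.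
  have mcos : measurable_fun setT (fun z : measurableTypeR R * RR => cos z.1).
    exact: (measurableT_comp (continuous_measurable_fun (@continuous_cos R))).
  have msin : measurable_fun setT (fun z : measurableTypeR R * RR => sin z.1).
    exact: (measurableT_comp (continuous_measurable_fun (@continuous_sin R))).
  have m1 : measurable_fun setT (fun z : measurableTypeR R * RR => z.2.1).
    exact: (measurableT_comp measurable_fst).
  have m2 : measurable_fun setT (fun z : measurableTypeR R * RR => z.2.2).
    exact: (measurableT_comp measurable_snd).
  apply: measurable_fun_pair => /=.
    by apply: measurable_funB; exact: measurable_funM.
  by apply: measurable_funD; exact: measurable_funM.
(* The restriction of t to one period is put into the integrand, so that Tonelli is applied on the
   full product. *)
pose H : measurableTypeR R * RR -> \bar R := (G \o rot) \_ (D `*` setT).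
have mDT : measurable (D `*` [set: RR]) by exact: measurableX.
have mH : measurable_fun setT H.
  have := measurable_funS measurableT (@subsetT _ (D `*` setT)) (measurableT_comp mG mrot).
  exact: (measurable_restrictT _ mDT).1.
have H0 z : (0 <= H z)%E by rewrite /H patchE; case: ifPn => // _; exact: G0.
have HE t x : H (t, x) = ((fun t => G (cmul (cos t, sin t) x)) \_ D) t.
  rewrite /H !patchE; congr (if _ then _ else _).
  by apply/idP/idP; rewrite !inE; [case|split].
have pi20 : 0 < 2 * pi :> R by rewrite mulr_gt0 ?pi_gt0.
rewrite -(@lee_pmul2l _ (2 * pi)%:E)//.
(* For every t in the period the rotation by t preserves the integral of [G]. *)
have -> : ((2 * pi)%:E * \int[mu2]_x G x = \int[mu]_t \int[mu2]_x H (t, x))%E.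
  transitivity (\int[mu]_(t in D) (\int[mu2]_x G x))%E.
    by rewrite integral_cst// muleC; congr (_ * _)%E; rewrite /= lebesgue_measure_period.
  rewrite integral_mkcond; apply: eq_integral => t _.
  rewrite patchE; case: ifPn => tD; last first.
    rewrite [RHS]integral0_eq// => x _.
    by rewrite HE patchE (negbTE tD).
  rewrite -(@ge0_integral_rotation _ G (cos t, sin t))//= ?cos2Dsin2//.
  by apply: eq_integral => x _; rewrite HE patchE tD.
(* After the exchange the integrands are compared for each x: the inner integral is a circle mean on
   the disk and 0 off it. *)
rewrite (fubini_tonelli_prod mu mu mu mH H0).
have -> : ((2 * pi)%:E * ((C - c)%:E * mu2 (odisk r)) =
    \int[mu2]_(x in odisk r) ((C - c) * (2 * pi))%:E)%E.
  by rewrite integral_cst// muleA -EFinM (mulrC (2 * pi)).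
rewrite [leRHS]integral_mkcond; apply: ge0_le_integral => //.
- by move=> x _; exact: integral_ge0.
- exact: measurable_fun_fubini_tonelli_G.
- by apply: (measurable_restrictT _ mB).1; exact: measurable_cst.
move=> x _; rewrite patchE.
under eq_integral do rewrite HE.
rewrite -integral_mkcond.
have dE t : odisk r (cmul (cos t, sin t) x) = odisk r x.
  by rewrite /odisk /mkset sqrnorm_cmul /= cos2Dsin2 mul1r.
case: ifPn => [/[!inE] xB|xB]; last first.
  rewrite integral0_eq// => t _; rewrite /G patchE.
  by case: ifPn => //; rewrite inE dE -inE (negbTE xB).
rewrite [leLHS](_ : _ = \int[mu]_(t in D)
    (C%:E - f (cline a (cline 0 b x) (cos t, sin t))%R))%E; last first.
  apply: eq_integral => t _.
  by rewrite /G patchE mem_set ?dE// cline_cmul.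
(* At x = 0 the direction x b vanishes and the circle shrinks to the point [a], so the integrand is
   constant. *)
have [x0|x0] := eqVneq x 0.
  have -> : cline 0 b x = 0 by rewrite x0 cline0.
  under eq_integral => t _.
    rewrite (_ : cline a 0 (cos t, sin t) = a); last first.
      rewrite [RHS](surjective_pairing a).
      by congr pair; apply/rowP => j; rewrite !mxE /=; ring.
    over.
  rewrite integral_cst//= lebesgue_measure_period (EFinM (C - c)).
  rewrite lee_pmul2r// EFinB leeB//.
apply: (circle_mean_cstB pf) => //; first exact: cline_neq0.
move=> y y1; rewrite -cline_cmul; apply: dO.
rewrite /odisk /mkset sqrnorm_cmul; move: xB; rewrite /odisk/=; apply: le_lt_trans.
rewrite ler_piMl ?addr_ge0 ?sqr_ge0//.
by move: y1; rewrite /cdisk/= !subr0 expr1n.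
Qed.

End means.

(** * Lower limits and Fatou's lemma *)

Section liminf.
Context {R : realType}.
Local Open Scope ereal_scope.
Implicit Types (u : (\bar R)^nat) (l : \bar R).

Lemma limn_einf_sup_einfs u : limn_einf u = ereal_sup (range (einfs u)).
Proof. by rewrite limn_einf_lim; apply/cvg_lim => //; exact: cvg_einfs_sup. Qed.

Lemma limn_einf_ge u l : (\forall k \near \oo, l <= u k) -> l <= limn_einf u.
Proof.
move=> [n _ nu]; rewrite limn_einf_sup_einfs.
apply: le_trans (ereal_sup_ubound _); last by exists n.
by apply: le_ereal_inf_tmp => _ [k /= nk <-]; exact: nu.
Qed.

Lemma limn_einf_gt u l : l < limn_einf u -> \forall k \near \oo, l < u k.
Proof.
rewrite limn_einf_sup_einfs => /ereal_sup_gt[_ [n _ <-] ln].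
exists n => // k /= nk; apply: lt_le_trans ln _.
by apply: ereal_inf_lbound; exists k.
Qed.

(** Fatou's lemma in the form used for contradictions: a number strictly below the integral of [g]
    is strictly below the lower limit of the integrals, hence below almost all of them. *)
Lemma lt_fatou d (T : measurableType d) (mu : {measure set T -> \bar R})
    (D : set T) (f : (T -> \bar R)^nat) (g : T -> \bar R) l :
  measurable D -> (forall k, measurable_fun D (f k)) ->
  (forall k x, D x -> 0 <= f k x) ->
  measurable_fun D g -> (forall x, D x -> 0 <= g x) ->
  (forall x, D x -> g x <= limn_einf (f ^~ x)) ->
  l < \int[mu]_(x in D) g x ->
  \forall k \near \oo, l < \int[mu]_(x in D) f k x.
Proof.
move=> mD mf f0 mg g0 gf lg; apply: limn_einf_gt.
apply: lt_le_trans lg (le_trans _ (fatou mu mD mf f0)).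
apply: ge0_le_integral => //.
(* The lower limit is minus the upper limit of the negatives. *)
apply: (measurableT_comp (f := -%E)) => //.
apply: measurable_fun_limn_esup => k.
exact: (measurableT_comp (f := -%E)).
Qed.

End liminf.

Section odisk_measure.
Context {R : realType}.
Local Notation mu2 := (@lebesgue_measure R \x @lebesgue_measure R)%E.

(** The disk contains the square of half-side r / 2 and lies in the one of half-side r. *)
Lemma odisk_measure (r : R) : 0 < r ->
  exists m : R, 0 < m /\ mu2 (odisk r) = m%:E.
Proof.
move=> r0.
have mB : measurable (odisk r : set (measurableTypeR R * measurableTypeR R)).
  by apply: open_measurable2; exact: open_odisk.
pose box (s : R) : set (measurableTypeR R * measurableTypeR R) :=
  `[- s, s]%classic `*` `[- s, s]%classic.
have mbox s : measurable (box s) by apply: measurableX; exact: measurable_itv.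
have box_measure s : 0 < s -> mu2 (box s) = ((s + s) * (s + s))%:E.
  move=> s0; rewrite /box product_measure1E//; try exact: measurable_itv.
  by rewrite /= lebesgue_measure_itv /= lte_fin gtrN// opprK EFinM.
have le1 : (mu2 (box (r / 2)%R) <= mu2 (odisk r))%E.
  apply: le_measure; rewrite ?inE//.
  move=> x [] /=; rewrite !in_itv/= => /andP[h1 h2] /andP[h3 h4].
  rewrite /odisk/=; nra.
have le2 : (mu2 (odisk r) <= mu2 (box r))%E.
  apply: le_measure; rewrite ?inE//.
  move=> x; rewrite /odisk /= => h; rewrite /box/= !in_itv/=.
  by split; apply/andP; split; nra.
rewrite box_measure ?divr_gt0// in le1; rewrite box_measure// in le2.
have fin : mu2 (odisk r) \is a fin_num.
  by rewrite ge0_fin_numE// (le_lt_trans le2)// ltry.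
exists (fine (mu2 (odisk r))); split; last by rewrite fineK.
rewrite fine_gt0// (lt_le_trans _ le1) ?lte_fin//=; last nra.
by rewrite (le_lt_trans le2)// ltry.
Qed.

End odisk_measure.

(** * Slices of products *)

Section join.
Context {R : realType} {N M : nat}.
Implicit Types (z p : Cn R N) (w q : Cn R M) (x : Cn R (N + M)).

Definition lproj x : Cn R N := (lsubmx x.1, lsubmx x.2).
Definition rproj x : Cn R M := (rsubmx x.1, rsubmx x.2).

Lemma cjoinK x : cjoin (lproj x) (rproj x) = x.
Proof. by rewrite /cjoin /= !hsubmxK -surjective_pairing. Qed.

Lemma lproj_cjoin z w : lproj (cjoin z w) = z.
Proof. by rewrite /lproj /cjoin /= !row_mxKl -surjective_pairing. Qed.

Lemma rproj_cjoin z w : rproj (cjoin z w) = w.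
Proof. by rewrite /rproj /cjoin /= !row_mxKr -surjective_pairing. Qed.

Lemma cline_cjoin z w b c (l : R * R) :
  cline (cjoin z w) (cjoin b c) l = cjoin (cline z b l) (cline w c l).
Proof.
by rewrite /cjoin /cline /= !(scale_row_mx, add_row_mx, opp_row_mx).
Qed.

Lemma cline_cjoinr z w c (l : R * R) :
  cjoin z (cline w c l) = cline (cjoin z w) (cjoin 0 c) l.
Proof.
rewrite cline_cjoin; congr (cjoin _ _); rewrite [LHS](surjective_pairing z).
by congr pair; apply/rowP => j; rewrite !mxE /=; ring.
Qed.

Lemma cline_cjoinl z b w (l : R * R) :
  cjoin (cline z b l) w = cline (cjoin z w) (cjoin b 0) l.
Proof.
rewrite cline_cjoin; congr (cjoin _ _); rewrite [LHS](surjective_pairing w).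
by congr pair; apply/rowP => j; rewrite !mxE /=; ring.
Qed.

(** Balls are those of the sup norm, hence products of balls; this lets (P) be applied on a ball. *)
Lemma ball_row_mx (p z : 'rV[R]_N) (q w : 'rV[R]_M) (r : R) :
  ball (row_mx p q) r (row_mx z w) <-> ball p r z /\ ball q r w.
Proof.
split=> [[r0 h]|[[r0 h1] [_ h2]]].
  by split; split => // i j; [have := h i (lshift M j)|have := h i (rshift N j)];
    rewrite ?row_mxEl ?row_mxEr.
split => // i j; case: (split_ordP j) => k ->.
  by rewrite !row_mxEl; exact: h1.
by rewrite !row_mxEr; exact: h2.
Qed.

Lemma ball_cjoin p q (r : R) z w :
  ball (cjoin p q) r (cjoin z w) <-> ball p r z /\ ball q r w.
Proof.
split=> [[/ball_row_mx[h1 h2] /ball_row_mx[h3 h4]]|[[h1 h3] [h2 h4]]] //.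
by split; apply/ball_row_mx.
Qed.

Lemma ballE p q (r : R) x :
  ball (cjoin p q) r x <-> ball p r (lproj x) /\ ball q r (rproj x).
Proof. by rewrite -{1}(cjoinK x); exact: ball_cjoin. Qed.

Lemma cjoin_neq0l (b : Cn R N) (c : Cn R M) : b != 0 -> cjoin b c != 0.
Proof.
apply: contra_neq => /(congr1 lproj); rewrite lproj_cjoin => ->.
by congr pair; apply/matrixP => i j; rewrite !mxE.
Qed.

Lemma cjoin_neq0r (b : Cn R N) (c : Cn R M) : c != 0 -> cjoin b c != 0.
Proof.
apply: contra_neq => /(congr1 rproj); rewrite rproj_cjoin => ->.
by congr pair; apply/matrixP => i j; rewrite !mxE.
Qed.

Lemma lproj_continuous : continuous lproj.
Proof.
move=> x A /nbhs_ballP[e /= e0 eA]; apply/nbhs_ballP; exists e => // y.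
rewrite -{1}(cjoinK x) => /ballE[h _]; exact: eA.
Qed.

Lemma rproj_continuous : continuous rproj.
Proof.
move=> x A /nbhs_ballP[e /= e0 eA]; apply/nbhs_ballP; exists e => // y.
rewrite -{1}(cjoinK x) => /ballE[_ h]; exact: eA.
Qed.

Lemma cjoin_continuousr z : continuous (cjoin z : Cn R M -> Cn R (N + M)).
Proof.
move=> w A /nbhs_ballP[e /= e0 eA]; apply/nbhs_ballP; exists e => // y yw.
by apply: eA; apply/ball_cjoin; split => //; exact: ballxx.
Qed.

(** A line of direction [b] in the slice is a line of direction (0, b) in the product. *)
Lemma psh_slice (O : set (Cn R (N + M))) (f : Cn R (N + M) -> \bar R) z :
  psh O f -> psh [set w | O (cjoin z w)] (f \o cjoin z).
Proof.
move=> [oO foo uf mf]; split.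
- by apply: open_comp => // w _; exact: cjoin_continuousr.
- by move=> w; exact: foo.
- move=> w Ow; apply: usc_at_comp; first exact: cjoin_continuousr.
  exact: uf.
- move=> a b b0.
  have E l := cline_cjoinr z a b l.
  have := mf (cjoin z a) (cjoin 0 b) (cjoin_neq0r _ b0).
  congr (subharmonic _ _); first by apply/seteqP; split => l /=; rewrite E.
  by apply/funext => l /=; rewrite E.
Qed.

End join.

Lemma psh_sub (R : realType) n (O O' : set (Cn R n)) (f : Cn R n -> \bar R) :
  open O' -> O' `<=` O -> psh O f -> psh O' f.
Proof.
move=> oO' sO [oO foo uf mf]; split => //.
- by move=> x /sO; exact: foo.
- by move=> x /sO; exact: uf.
- move=> a b /(mf a b)[_ h1 h2 h3]; split.
  + by apply: open_comp => // l _; exact: cline_continuousr.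
  + by move=> l /sO; exact: h1.
  + by move=> l /sO; exact: h2.
  + move=> l r /sO Ol r0 dO; apply: h3 => // y /dO; exact: sO.
Qed.

(** * The parameter plane as the factor C^1 *)

Section axis.
Context {R : realType}.

Definition axis (l : R * R) : Cn R 1 := (const_mx l.1, const_mx l.2).
Definition unaxis (x : Cn R 1) : R * R := (x.1 0 0, x.2 0 0).

Lemma axisK : cancel axis unaxis.
Proof. by move=> l; rewrite /unaxis /axis /= !mxE -surjective_pairing. Qed.

Lemma unaxisK : cancel unaxis axis.
Proof.
move=> x; rewrite [RHS](surjective_pairing x) /axis /unaxis /=.
by congr pair; apply/rowP => j; rewrite !mxE (ord1 j).
Qed.

Lemma axis1_neq0 : axis (1, 0) != 0.
Proof.
apply/eqP => /(congr1 unaxis); rewrite axisK => -[/eqP].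
by rewrite mxE oner_eq0.
Qed.

Lemma cline_axis (a l : R * R) : cline (axis a) (axis (1, 0)) l = axis (a + l).
Proof. by congr pair; apply/rowP => j; rewrite !mxE /=; ring. Qed.

Lemma ball_axis (a l : R * R) r : ball (axis a) r (axis l) <-> ball a r l.
Proof.
split=> [[[r0 h1] [_ h2]]|[h1 h2]].
  by split; [have := h1 0 0|have := h2 0 0]; rewrite !mxE.
have r0 : 0 < r.
  by move: h1; rewrite /ball /= => /(le_lt_trans (normr_ge0 _)).
by split; split => // i j; rewrite !mxE.
Qed.

Lemma unaxis_continuous : continuous unaxis.
Proof.
move=> x A /nbhs_ballP[e /= e0 eA]; apply/nbhs_ballP; exists e => // y.
by rewrite -{1}(unaxisK x) -{1}(unaxisK y) => /ball_axis; exact: eA.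
Qed.

End axis.

(** * Upper limits along convergent sequences *)

Lemma ereal_lt_dense (R : realType) (x y : \bar R) :
  (x < y)%E -> exists2 c : R, (x < c%:E)%E & (c%:E < y)%E.
Proof.
case: x => [x| |] //; case: y => [y| |] // xy.
- by exists ((x + y) / 2); move: xy; rewrite !lte_fin => ?; lra.
- by exists (x + 1); rewrite ?ltry// lte_fin ltrDl.
- by exists (y - 1); rewrite ?ltNyr// lte_fin ltrBlDr ltrDl.
- by exists 0; rewrite ?ltNyr ?ltry.
Qed.

Lemma odisk_ball (R : realType) (r : R) (x : R * R) :
  0 < r -> odisk r x -> ball (0 : R * R) r x.
Proof.
move=> r0; rewrite /odisk /= => h; split; rewrite /ball /= sub0r normrN.
  by rewrite ltr_norml; apply/andP; split; nra.
by rewrite ltr_norml; apply/andP; split; nra.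
Qed.

Lemma ball0_shift (R : realType) (r : R) (a x : R * R) :
  ball (0 : R * R) r x -> ball a r (a + x).
Proof.
by move=> [h1 h2]; split; [move: h1|move: h2]; rewrite /ball /= opprD addrA subrr.
Qed.

Lemma nbhs_odisk (R : realType) (A : set (R * R)) (e : R) : 0 < e -> nbhs (0 : R * R) A ->
  exists r, [/\ 0 < r, r <= e & odisk r `<=` A].
Proof.
move=> e0 /nbhs_ballP[d /= d0 dA]; exists (Num.min d e).
have m0 : 0 < Num.min d e by rewrite lt_min d0.
split => //; first by rewrite ge_min lexx orbT.
move=> x /(odisk_ball m0) h; apply: dA; apply: le_ball h.
by rewrite ge_min lexx.
Qed.

Section upper_limits.
Context {R : realType}.
Local Notation RR := (measurableTypeR R * measurableTypeR R)%type.
Local Notation mu2 := (@lebesgue_measure R \x @lebesgue_measure R)%E.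

(** Stated for varying functions at varying points, with [u] semicontinuous along lines only,
    because all of this passes to slices: the induction applies to the functions v_k(x, .) at the
    points b_k. *)
Lemma psh_upper_limit (N : nat) (p : Cn R N) (r C : R)
    (v : nat -> Cn R N -> \bar R) (y : nat -> Cn R N) (u : Cn R N -> \bar R) (c : R) :
  0 < r -> 0 <= C ->
  (forall k, psh (ball p r) (v k)) ->
  (forall k x, ball p r x -> (v k x <= C%:E)%E) ->
  (forall k x, ball p r x -> (v k x <= u x)%E) ->
  (forall a b, b != 0 -> forall l, ball p r (cline a b l) ->
    usc_at (u \o cline a b) l) ->
  y k @[k --> \oo] --> p -> (u p < c%:E)%E ->
  \forall k \near \oo, (v k (y k) < c%:E)%E.
Proof.
move=> + C0; elim: N p r v y u c => [|N IH] p r v y u c r0 pv vC vu uu yp upc.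
  (* C^0 has a single point. *)
  near=> k; have -> : y k = p.
    rewrite (surjective_pairing (y k)) (surjective_pairing p).
    by congr pair; apply/rowP => -[].
  by apply: le_lt_trans upc; apply: vu; exact: ballxx.
(* The gap between [c0] and [c] provides the strict inequality that Fatou's lemma needs. *)
have [c0 upc0] := ereal_lt_dense upc; rewrite lte_fin => c0c.
(* If C < c0 the bound [C] already suffices; otherwise C - c0 >= 0 can serve as the minorant in
   Fatou's lemma. *)
have [c0C|Cc0] := leP c0 C; last first.
  near=> k; apply: (@le_lt_trans _ _ C%:E); last by rewrite lte_fin; lra.
  by apply: vC; near: k; apply: yp; exact: nbhsx_ballx.
pose p1 := unaxis (lproj (p : Cn R (1 + N))).
pose p2 := rproj (p : Cn R (1 + N)).
have pE : p = cjoin (axis p1) p2 by rewrite /p1 unaxisK cjoinK.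
(* [y'] replaces the finitely many [y k] far from [p], so that all the disks
   used below stay in the ball. *)
pose y' k := if `[< ball p (r / 2) (y k) >] then y k else p.
have y'y : \forall k \near \oo, y' k = y k.
  near=> k; rewrite /y'; case: asboolP => // -[]; near: k; apply: yp.
  by apply: nbhsx_ballx; rewrite divr_gt0.
pose a k := unaxis (lproj (y' k : Cn R (1 + N))).
pose b k := rproj (y' k : Cn R (1 + N)).
have y'E k : y' k = cjoin (axis (a k)) (b k) by rewrite /a unaxisK cjoinK.
have y'p : y' k @[k --> \oo] --> p.
  apply: cvg_trans yp; apply: near_eq_cvg.
  by apply: filterS y'y => k ->.
have y'r k : ball p (r / 2) (y' k).
  by rewrite /y'; case: asboolP => // _; apply: ballxx; rewrite divr_gt0.
have ar k : ball p1 (r / 2) (a k).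
  have := y'r k; rewrite pE => /(@ballE R 1 N)[+ _].
  by rewrite -{1}(unaxisK (lproj _)) => /ball_axis.
have br k : ball p2 (r / 2) (b k).
  by have := y'r k; rewrite pE => /(@ballE R 1 N)[].
have ap : a k @[k --> \oo] --> p1.
  have cont : {for p, continuous (unaxis \o @lproj R 1 N)}.
    apply: continuous_comp; first exact: lproj_continuous.
    exact: unaxis_continuous.
  exact: (cvg_comp _ _ y'p cont).
have bp : b k @[k --> \oo] --> p2.
  exact: (cvg_comp _ _ y'p (@rproj_continuous R 1 N p)).
pose e := cjoin (axis (1, 0) : Cn R 1) (0 : Cn R N).
have e0 : e != 0 by apply: cjoin_neq0l; exact: axis1_neq0.
have lineE a' w x : cline (cjoin (axis a') w) e x = cjoin (axis (a' + x)) w.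
  by rewrite -cline_cjoinl cline_axis.
have r2 : r / 2 + r / 2 = r by lra.
have inQ (a' : R * R) (w : Cn R N) (x : R * R) : ball p1 (r / 2) a' -> ball p2 (r / 2) w ->
    ball (0 : R * R) (r / 2) x -> ball p r (cjoin (axis (a' + x)) w).
  move=> h1 h2 h3; rewrite pE; apply/(@ball_cjoin R 1 N); split.
    apply/ball_axis; rewrite -r2; apply: ball_triangle h1 _.
    exact: ball0_shift.
  by apply: le_ball h2; lra.
(* Semicontinuity of [u] on the line through [p] in the first coordinate direction. *)
have u0 : nbhs (0 : R * R) [set x : R * R | (u (cjoin (axis (p1 + x)) p2)%R < c0%:E)%E].
  have := uu p e e0 0; rewrite cline0 => /(_ (ballxx _ r0)).
  move=> /(_ c0); rewrite /comp cline0 => /(_ upc0).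
  by apply: filterS => x; rewrite {1}pE lineE.
have [rho [rho0 rhor rhou]] := nbhs_odisk (divr_gt0 r0 (ltr0Sn _ 1)) u0.
have rhob x : odisk rho x -> ball (0 : R * R) (r / 2) x.
  by move=> /(odisk_ball rho0); exact: le_ball.
pose f k (x : R * R) := v k (cline (y' k) e x).
have fin k x : odisk rho x -> ball p r (cline (y' k) e x) /\ (f k x <= C%:E)%E.
  move=> /rhob xr; have h : ball p r (cline (y' k) e x).
    by rewrite y'E lineE; exact: inQ.
  by split => //; exact: vC.
pose G k : RR -> \bar R := ((fun x => C%:E - f k x)%E \_ (odisk rho)).
have G0 k x : (0 <= G k x)%E.
  rewrite /G patchE; case: ifPn => //; rewrite inE => /(fin k)[_ fC].
  by rewrite sube_ge0 ?fC//= orbT.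
have mG k : measurable_fun setT (G k).
  apply: lsc_measurable2; apply: lsc_cstB_patch => //; first exact: open_odisk.
    move=> x /(fin k)[Ox _]; apply: usc_at_comp; first exact: cline_continuousr.
    by case: (pv k) => _ _ + _; exact.
  by move=> x /(fin k)[].
have [m [m0 mE]] := odisk_measure rho0.
(* Translating by [d k] turns a_k + x into p1 + x: where x + d_k lies in the disk, [H k x] is C -
   v_k(p1 + x, b_k), with a first argument independent of k. *)
pose d k : R * R := (p1.1 - (a k).1, p1.2 - (a k).2).
pose H k (x : RR) := G k (x.1 + (d k).1, x.2 + (d k).2).
have mH k : measurable_fun setT (H k).
  apply: (measurableT_comp (mG k)).
  by apply: measurable_fun_pair => /=; exact: measurable_funD.
have mB : measurable (odisk rho : set RR).
  by apply: open_measurable2; exact: open_odisk.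
have d0 : d k @[k --> \oo] --> (0 : R * R).
  apply/cvg_ballP => eps eps0; have := (cvg_ballP _ _).1 ap eps eps0.
  by case=> n _ h; exists n => // k /h [h1 h2]; split; rewrite /ball /= sub0r normrN.
have key : \forall k \near \oo, (((C - c) * m)%:E < \int[mu2]_x H k x)%E.
  apply: (@lt_fatou R _ RR mu2 setT H ((cst (C - c0)%:E : RR -> \bar R) \_ (odisk rho))) => //.
  - by move=> k x _; exact: G0.
  - by apply: (measurable_restrictT _ mB).1; exact: measurable_cst.
  - move=> x _; rewrite patchE; case: ifPn => // _; rewrite lee_fin; lra.
  - move=> x _; apply: limn_einf_ge; rewrite patchE.
    case: ifPn => [/[!inE] xB|_]; last by near=> k; exact: G0.
    (* The disk is open and d_k tends to 0, so a fixed x is eventually covered by the translated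
       disks. *)
    have near1 : \forall k \near \oo, odisk rho (x.1 + (d k).1, x.2 + (d k).2).
      have : (x : R * R) + d k @[k --> \oo] --> (x : R * R) + 0.
        by apply: cvgD => //; exact: cvg_cst.
      rewrite addr0; apply; apply: open_nbhs_nbhs; split => //.
      exact: open_odisk.
    have near2 : \forall k \near \oo,
        (v k (cjoin (axis (p1 + x)) (b k))%R < c0%:E)%E.
      have xr : ball p1 r (p1 + x).
        by apply: ball0_shift; apply: le_ball (rhob _ xB); lra.
      have sub w : ball p2 r w -> ball p r (cjoin (axis (p1 + x)) w).
        by move=> h; rewrite pE; apply/(@ball_cjoin R 1 N); split => //; apply/ball_axis.
      apply: (IH p2 r (fun k => v k \o cjoin (axis (p1 + x))) b
        (u \o cjoin (axis (p1 + x)))) => //.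
      + move=> k; apply: psh_sub (@psh_slice R 1 N _ _ (axis (p1 + x)) (pv k)).
          exact: ball_open.
        exact: sub.
      + by move=> k w /sub; exact: vC.
      + by move=> k w /sub; exact: vu.
      + move=> a' b' b'0 l /sub; rewrite cline_cjoinr => h.
        have := uu _ _ (@cjoin_neq0r R 1 N 0 _ b'0) _ h.
        congr (usc_at _ _); apply/funext => l' /=.
        by rewrite cline_cjoinr.
      + exact: rhou.
    near=> k; rewrite /H /G patchE mem_set; last by near: k.
    rewrite ltW// lt_cstB (_ : C - (C - c0) = c0); last by ring.
    rewrite /f y'E lineE.
    rewrite (_ : a k + _ = p1 + x); last first.
      by rewrite /d; apply/pair_equal_spec; split => /=; rewrite addrC -addrA subrK addrC.
    by near: k.
  - apply: (@lt_le_trans _ _ ((C - c0) * m)%:E).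
      by rewrite lte_fin ltr_pM2r//; lra.
    by rewrite -integral_mkcond integral_cst// EFinM -mE.
near=> k; rewrite -(near y'y k)//.
(* If v_k(y_k) >= c, the area mean bounds the integral of [G k] by (C - c) m; by translation
   invariance this is the integral of [H k], against [key]. *)
rewrite ltNge; apply/negP => cv.
have : (((C - c) * m)%:E < \int[mu2]_x H k x)%E by near: k.
rewrite (ge0_integral_add2 (d k) (mG k) (G0 k)) ltNge => /negP; apply.
rewrite EFinM -mE.
exact: (area_mean (pv k) e0 C0 (fin k) cv).
Unshelve. all: by end_near.
Qed.

End upper_limits.

(** * Local boundedness *)

(** Connected as a union of segments issuing from the centre. *)
Lemma ball_domain (R : realType) n (p : Cn R n) (r : R) :
  0 < r -> domain (ball p r).
Proof.
move=> r0; split; first exact: ball_open.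
have -> : ball p r = \bigcup_(x in ball p r) ((fun t : R => p + t *: (x - p)) @` `[0, 1]).
  apply/seteqP; split=> [x px|y [x px [t /= /[!in_itv]/= /andP[t0 t1] <-]]].
    exists x => //; exists 1; first by rewrite /= in_itv /= ler01 lexx.
    by rewrite scale1r addrC subrK.
  move: px; rewrite -!ball_normE /= opprD addrA subrr sub0r normrN normrZ.
  rewrite distrC => xr; apply: le_lt_trans xr.
  by rewrite ler_piMl// ger0_norm.
apply: bigcup_connected.
  exists p => x _; exists 0; first by rewrite /= in_itv /= lexx ler01.
  by rewrite scale0r addr0.
move=> x _; apply: connected_continuous_connected; first exact: segment_connected.
apply: continuous_subspaceT => t.
by apply: cvgD; [exact: cvg_cst|apply: cvgZr_tmp].
Qed.

Lemma compact_box (R : realType) n (p : Cn R n) (r : R) :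
  exists K : set (Cn R n), compact K /\ ball p r `<=` K /\
    forall s, r < s -> K `<=` ball p s.
Proof.
pose K1 (q : 'rV[R]_n) := [set x : 'rV[R]_n |
  forall j, [set` `[q 0 j - r, q 0 j + r]] (x ord0 j)].
have cK q : compact (K1 q).
  by apply: (@rV_compact _ _ (fun j => [set` `[q 0 j - r, q 0 j + r]])) => j;
     exact: segment_compact.
have bK q : ball q r `<=` K1 q.
  move=> x [_ h] j; have := h 0 j; rewrite /ball /= in_itv /= -ler_distlC.
  by rewrite distrC => /ltW; rewrite distrC.
have Kb q s : 0 < s -> r < s -> K1 q `<=` ball q s.
  move=> s0 rs x h; split => // i j; rewrite (ord1 i); have := h j.
  by rewrite /ball /= in_itv /= -ler_distlC => /le_lt_trans; apply.
(* For r < 0 the empty set is taken: when n = 0 the box would be the whole space, while balls of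
   radius at most 0 are empty. *)
have [r0|r0] := leP 0 r.
  exists (K1 p.1 `*` K1 p.2); split; first exact: compact_setX.
  split=> [x [h1 h2]|s rs x [h1 h2]]; first by split; exact: bK.
  by have s0 := le_lt_trans r0 rs; split; exact: Kb.
exists set0; split; first exact: compact0.
split=> // x [[/ltW]]; rewrite leNgt r0//.
Qed.

(** A bound valid near a point remains valid for all larger constants, so compactness, in the form
    of near coverings along +oo, yields a common one. *)
Lemma usc_bounded_compact (R : realType) (T : topologicalType) (f : T -> \bar R)
    (K : set T) : compact K ->
  (forall x, K x -> (f x < +oo)%E /\ usc_at f x) ->
  exists c : R, forall x, K x -> (f x <= c%:E)%E.
Proof.
move=> /compact_near_coveringP cK fK.
have : \forall c \near +oo, K `<=` (fun x => (f x <= c%:E)%E).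
  apply: cK => x Kx; have [foo uf] := fK x Kx.
  have [c0 fc0] : exists c0 : R, (f x < c0%:E)%E.
    case: (f x) foo => [t| |] // _; last by exists 0; rewrite ltNyr.
    by exists (t + 1); rewrite lte_fin ltrDl.
  exists ([set y | (f y < c0%:E)%E], [set c | c0 <= c]) => /=.
    by split; [exact: uf|apply: nbhs_pinfty_ge; exact: num_real].
  move=> [y c] /= [fy c0c]; apply: ltW; apply: lt_le_trans fy _.
  by rewrite lee_fin.
by move=> /pinfty_ex_gt0[c _ cP]; exists c.
Qed.

(** What the minorants inherit at once from the semicontinuity of [u] along lines; it is stable
    under slicing. *)
Definition bdd_on_lines (R : realType) n (U : set (Cn R n -> \bar R))
    (O : set (Cn R n)) :=
  forall (a b : Cn R n) (K : set (R * R)), b != 0 -> compact K ->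
    (forall l, K l -> O (cline a b l)) ->
    exists c : R, forall v l, U v -> K l -> (v (cline a b l) <= c%:E)%E.

Section local_bound.
Context {R : realType}.

(** A compact set in C x {w} lies on one line, and its parameters, the image under the first
    projection, form a compact set. *)
Lemma bdd_on_lines_slice N (U : set (Cn R (1 + N) -> \bar R)) O C w :
  bdd_on_lines U O -> compact C -> C `<=` O -> (forall x, C x -> rproj x = w) ->
  exists c : R, forall v x, U v -> C x -> (v x <= c%:E)%E.
Proof.
move=> bU cC CO Cw.
pose a := cjoin (axis 0) w : Cn R (1 + N).
pose b := cjoin (axis (1, 0)) 0 : Cn R (1 + N).
have E x : C x -> x = cline a b (unaxis (lproj x)).
  move=> Cx; rewrite -{1}(cjoinK x) (Cw _ Cx) -cline_cjoinl cline_axis add0r.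
  by rewrite unaxisK.
have [||l [x Cx <-]|c cP] := bU a b ((unaxis \o lproj) @` C).
- by apply: cjoin_neq0l; exact: axis1_neq0.
- apply: continuous_compact => //; apply: continuous_subspaceT => x.
  by apply: continuous_comp; [exact: lproj_continuous|exact: unaxis_continuous].
- by rewrite -E//; exact: CO.
exists c => v x Uv Cx; rewrite (E x Cx); apply: cP => //.
by exists x.
Qed.

Lemma cprod_ball N M (p : Cn R (N + M)) r :
  cprod (ball (lproj p) r) (ball (rproj p) r) = ball p r.
Proof.
apply/seteqP; split=> [_ [z [w [zp wp ->]]]|x].
  by rewrite -(cjoinK p); apply/ball_cjoin.
rewrite -{1}(cjoinK p) => /ballE[h1 h2].
by exists (lproj x), (rproj x); split => //; rewrite cjoinK.
Qed.

(** Induction on the dimension 1 + N. In the inductive step (P) is used with a disk in C and a ball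
    in the remaining variables: slices with w fixed lie on lines, slices with z fixed fall under the
    induction hypothesis. *)
Lemma locally_bounded_of_lines (P : statementP R) N (p : Cn R (1 + N)) (r : R)
    (U : set (Cn R (1 + N) -> \bar R)) : 0 < r ->
  (forall v, U v -> psh (ball p r) v) -> bdd_on_lines U (ball p r) ->
  loc_unif_bdd_above U (ball p r).
Proof.
elim: N p r U => [|N IH] p r U r0 pU bU.
  move=> C cC CO; apply: (bdd_on_lines_slice (w := 0) bU cC CO) => x _.
  rewrite (surjective_pairing (rproj x)).
  by congr pair; apply/rowP => -[].
have := P 1 N.+1 isT isT (ball (lproj (p : Cn R (1 + N.+1))) r)
  (ball (rproj (p : Cn R (1 + N.+1))) r) U (ball_domain _ r0) (ball_domain _ r0).
rewrite cprod_ball; apply => //.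
- move=> w wp C cC Cw; apply: (bdd_on_lines_slice (w := w) bU cC) => x /Cw.
    case=> z [w' [zp -> ->]]; rewrite -(cjoinK (p : Cn R (1 + N.+1))).
    exact/(@ball_cjoin R 1 N.+1).
  by case=> z [w' [_ -> ->]]; exact: rproj_cjoin.
- move=> z zp C cC Cz.
  have subz w : ball (rproj (p : Cn R (1 + N.+1))) r w ->
      ball p r (cjoin z w : Cn R (1 + N.+1)).
    move=> wp; rewrite -(cjoinK (p : Cn R (1 + N.+1))).
    exact/(@ball_cjoin R 1 N.+1).
  have [_ [v Uv <-]|a b K b0 cK Kb||_ [x Cx <-]|c cP] :=
      IH (rproj (p : Cn R (1 + N.+1))) r
    [set v \o @cjoin R 1 N.+1 z | v in U] r0 _ _ (@rproj R 1 N.+1 @` C).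
  + apply: psh_sub (@psh_slice R 1 N.+1 _ _ z (pU _ Uv)); last exact: subz.
    exact: ball_open.
  + have [||c cP] := bU (@cjoin R 1 N.+1 z a) (@cjoin R 1 N.+1 0 b) K _ cK.
    * exact: cjoin_neq0r.
    * by move=> l /Kb /subz; rewrite cline_cjoinr.
    exists c => _ l [v Uv <-] Kl /=; rewrite cline_cjoinr; exact: cP.
  + apply: continuous_compact => //; apply: continuous_subspaceT => x.
    exact: rproj_continuous.
  + by case: (Cz _ Cx) => z' [w [_ wp ->]]; rewrite rproj_cjoin.
  exists c => v x Uv Cx; have xE : x = @cjoin R 1 N.+1 z (rproj x).
    by case: (Cz _ Cx) => z' [w [-> wp ->]]; rewrite rproj_cjoin.
  rewrite xE; apply: (cP (v \o @cjoin R 1 N.+1 z)); first by exists v.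
  by exists x.
Qed.

End local_bound.

(** * Regularization of the envelope *)

(** The upper limit of [s] at [z], the point [z] itself included, so that it dominates [s]. *)
Definition usc_reg (R : realType) (T : topologicalType) (s : T -> \bar R) (z : T) :
  \bar R := ereal_inf [set c | \forall y \near z, (s y <= c)%E].

Section usc_regularization.
Context {R : realType} {T : topologicalType}.
Implicit Types (s : T -> \bar R) (z : T).

Lemma le_usc_reg s z : (s z <= usc_reg s z)%E.
Proof. by apply: le_ereal_inf_tmp => c /nbhs_singleton. Qed.

(** A bound for [s] near [z] is also a bound near every point close to [z]. *)
Lemma usc_at_usc_reg s z : usc_at (usc_reg s) z.
Proof.
move=> c /ereal_inf_lt[c' /nbhs_interior sc' c'c].
apply: filterS sc' => y yc'; apply: le_lt_trans c'c.
exact: ereal_inf_lbound.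
Qed.

Lemma lt_usc_reg s z c (A : set T) : (c < usc_reg s z)%E -> nbhs z A ->
  exists2 y, A y & (c < s y)%E.
Proof.
move=> cz zA; apply: contrapT => /forall2NP h.
move: cz; rewrite ltNge => /negP; apply; apply: ereal_inf_lbound.
by apply: filterS zA => y Ay; case: (h y) => // /negP; rewrite -leNgt.
Qed.

End usc_regularization.

Lemma compact_cdisk (R : realType) : compact (cdisk (0 : R * R) 1).
Proof.
have cbox : compact (`[(-1 : R), 1] `*` `[(-1 : R), 1]).
  by apply: compact_setX; exact: segment_compact.
apply: (subclosed_compact _ cbox).
  have -> : cdisk (0 : R * R) 1 =
    (fun x : R * R => x.1 ^+ 2 + x.2 ^+ 2) @^-1` [set y | y <= 1].
    by apply/seteqP; split => x; rewrite /cdisk /= !subr0 expr1n.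
  apply: closed_comp; last exact: closed_le.
  move=> x _; have c1 : {for x, continuous (fun x : R * R => x.1)} by exact: cvg_fst.
  have c2 : {for x, continuous (fun x : R * R => x.2)} by exact: cvg_snd.
  by apply: cvgD; rewrite expr2; under eq_fun do rewrite expr2; apply: cvgM.
move=> x; rewrite /cdisk /= !subr0 expr1n => h; rewrite !in_itv/=.
by split; apply/andP; split; nra.
Qed.

(** * The regularized envelope is a plurisubharmonic minorant *)

Section envelope.
Context {R : realType} {N : nat}.
Variables (O : set (Cn R N)) (u : Cn R N -> \bar R).
Hypothesis oO : open O.
Hypothesis uoo : forall x, O x -> (u x < +oo)%E.
Hypothesis ul : forall a b : Cn R N, b != 0 ->
  subharmonic [set lam | O (cline a b lam)] (u \o cline a b).

Let U := [set v : Cn R N -> \bar R | psh O v /\ forall x, O x -> (v x <= u x)%E].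
Let s := psh_envelope O u.
Let s' := usc_reg s.

Lemma minorants_locally_bounded (P : statementP R) p : O p ->
  exists r C : R, [/\ 0 < r, 0 <= C, ball p r `<=` O &
    forall v x, U v -> ball p r x -> (v x <= C%:E)%E].
Proof.
move=> Op; have /nbhs_ballP[r /= r0 rO] : nbhs p O by apply: open_nbhs_nbhs.
(* (P) concerns positive dimensions; in C^0 the value of [u] at the only point is a bound. *)
have [N0|[M NE]] : N = 0%N \/ exists M, N = M.+1.
  by case: (N) => [|M]; [left|right; exists M].
  have [C uC _] := ereal_lt_dense (uoo Op).
  exists r, (Num.max C 0); split => //; first by rewrite le_max lexx orbT.
  move=> v x [_ vu] xr; have -> : x = p.
    rewrite (surjective_pairing x) (surjective_pairing p).
    by congr pair; apply/rowP => j; suff: False by []; case: j; rewrite N0.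
  apply: le_trans (vu _ Op) _; apply: le_trans (ltW uC) _.
  by rewrite lee_fin le_max lexx.
(* A compact set between the balls of radii r / 2 and r carries the local bound over to the smaller
   ball. *)
have [K [cK [bK Kb]]] := compact_box p (r / 2).
have Ub : loc_unif_bdd_above U (ball p r).
  have pU v : U v -> psh (ball p r) v.
    by move=> [pv _]; apply: psh_sub pv => //; exact: ball_open.
  have bU : bdd_on_lines U (ball p r).
    move=> a b L b0 cL LO; have [_ h1 h2 _] := ul a b0.
    have [|c cP] := usc_bounded_compact (f := u \o cline a b) cL.
      by move=> l /LO /rO Ol; split; [exact: h1|exact: h2].
    exists c => v l [_ vu] Ll; apply: le_trans (cP l Ll).
    by apply: vu; apply: rO; exact: LO.
  move: (p) (U) pU bU; rewrite NE => q V.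
  exact: (locally_bounded_of_lines P).
have r2 : r / 2 < r by lra.
have [c cP] := Ub K cK (Kb _ r2).
exists (r / 2), (Num.max c 0); split.
- by rewrite divr_gt0.
- by rewrite le_max lexx orbT.
- by apply: subset_trans rO; apply: le_ball; exact: ltW.
- move=> v x Uv /bK Kx; apply: le_trans (cP _ _ Uv Kx) _.
  by rewrite lee_fin le_max lexx.
Qed.

(** Choose y_k in [A] within 1 / (k + 1) of [p] with s(y_k) > c, then a minorant exceeding [c] at
    y_k. *)
Lemma minorant_sequence p c (A : set (Cn R N)) : (c < s' p)%E -> nbhs p A ->
  exists y v, [/\ y k @[k --> \oo] --> p, forall k : nat, A (y k),
    forall k, U (v k) & forall k, (c < v k (y k))%E].
Proof.
move=> cp pA.
have /choice[yv h] : forall k : nat, exists yv : Cn R N * (Cn R N -> \bar R),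
    [/\ A yv.1, ball p k.+1%:R^-1 yv.1, U yv.2 & (c < yv.2 yv.1)%E].
  move=> k; have [||y [Ay yp] cy] := @lt_usc_reg _ _ s p c (A `&` ball p k.+1%:R^-1).
  - exact: cp.
  - by apply: filterI => //; apply: nbhsx_ballx.
  by have [_ [v Uv <-] cv] := ereal_sup_gt cy; exists (y, v).
exists (fun k => (yv k).1), (fun k => (yv k).2); split => [|k|k|k]; try by case: (h k).
apply/cvg_ballP => e e0; near=> k.
have [_ + _ _] := h k; apply: le_ball; apply: ltW.
near: k; exact: near_infty_natSinv_lt (PosNum e0).
Unshelve. all: by end_near. Qed.

Lemma usc_reg_envelope_ltoo (P : statementP R) p : O p -> (s' p < +oo)%E.
Proof.
move=> /(minorants_locally_bounded P)[r [C [r0 _ _ bC]]].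
apply: le_lt_trans (ltry C); apply: ereal_inf_lbound.
rewrite /=; near=> x; have xr : ball p r x by near: x; exact: nbhsx_ballx.
by apply: ge_ereal_sup => _ [v Uv <-]; exact: bC.
Unshelve. all: by end_near.
Qed.

Lemma usc_reg_envelope_le (P : statementP R) p : O p -> (s' p <= u p)%E.
Proof.
move=> Op; rewrite leNgt; apply/negP => /ereal_lt_dense[c uc cs].
have [r [C [r0 C0 rO bC]]] := minorants_locally_bounded P Op.
have [y [v [yp yr vU cv]]] := minorant_sequence cs (nbhsx_ballx p r r0).
have : \forall k \near \oo, (v k (y k) < c%:E)%E.
  apply: (@psh_upper_limit _ _ p r C v y u) => //.
  - by move=> k; case: (vU k) => pv _; apply: psh_sub pv => //; exact: ball_open.
  - by move=> k x; exact: bC.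
  - by move=> k x /rO; case: (vU k) => _; exact.
  - by move=> a b b0 l /rO Ol; have [_ _ + _] := ul a b0; exact.
by move=> /filter_ex[k]; rewrite ltNge ltW.
Qed.

Lemma usc_reg_envelope_circle_mean (P : statementP R) a b : b != 0 ->
  (forall x, cdisk 0 1 x -> O (cline a b x)) ->
  ((2 * pi)%:E * s' a <= \int[@lebesgue_measure R]_(t in `[0%R, (2 * pi)%R])
     s' (cline a b (cos t, sin t)))%E.
Proof.
move=> b0 dO; have pi20 : 0 < 2 * pi :> R by rewrite mulr_gt0 ?pi_gt0.
(* Pairs of a base point near [a] and a large constant: compactness of the unit disk then yields at
   once a neighbourhood [A] of [a] and one bound [C] for all disks based in [A]. *)
pose F := filter_prod (nbhs a) (pinfty_nbhs R).
pose Q (i : Cn R N * R) (x : R * R) :=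
  O (cline i.1 b x) /\ (s' (cline i.1 b x) <= i.2%:E)%E.
have : \near F, cdisk 0 1 `<=` Q F.
  apply: (compact_near_coveringP _).1; first exact: compact_cdisk.
  move=> x /dO Ox; have [C sC _] := ereal_lt_dense (usc_reg_envelope_ltoo P Ox).
  have W : nbhs (cline a b x) [set z | O z /\ (s' z < C%:E)%E].
    by apply: filterI; [exact: open_nbhs_nbhs|exact: usc_at_usc_reg sC].
  case: (@cline_continuous R N b (a, x) _ W) => -[A B] /= [aA xB] AB.
  exists (B, A `*` [set c | C <= c]).
    split => //; exists (A, [set c | C <= c]) => //; split => //.
    by apply: nbhs_pinfty_ge; exact: num_real.
  move=> [x' [y c]] /= [Bx' [Ay Cc]].
  have [Oy sy] := AB (y, x') (conj Ay Bx').
  split => //; apply: le_trans (ltW sy) _; by rewrite lee_fin.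
move=> [[A B] /= [aA Boo] AB].
have [C C0 BC] := pinfty_ex_gt0 Boo.
have AQ y : A y -> forall x, cdisk 0 1 x ->
    O (cline y b x) /\ (s' (cline y b x) <= C%:E)%E.
  by move=> Ay x; exact: (AB (y, C) (conj Ay BC)).
have vs' v x : U v -> (v x <= s' x)%E.
  move=> Uv; apply: le_trans (le_usc_reg _ _).
  by apply: ereal_sup_ubound; exists v.
have ms y : measurable_fun `[0%R, (2 * pi)%R]
    (fun t => s' (cline y b (cos t, sin t))).
  by apply: measurable_circle => t; exact: usc_at_usc_reg.
have mCs y : measurable_fun `[0%R, (2 * pi)%R]
    (fun t => C%:E - s' (cline y b (cos t, sin t))%R)%E.
  by apply: emeasurable_funB; [exact: measurable_cst|exact: ms].
have sC y : A y -> forall t, (s' (cline y b (cos t, sin t)) <= C%:E)%E.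
  by move=> Ay t; have [] := AQ _ Ay _ (circle_in_cdisk t).
have Aa : A a by exact: nbhs_singleton.
(* By contradiction: Fatou for C - s' on the circles about y_k makes their integrals exceed (C - c)
   2 pi eventually, while s' >= v_k and the circle mean of v_k at y_k bound them by that number. *)
have main c : (c%:E < s' a)%E -> ((2 * pi * c)%:E <=
    \int[@lebesgue_measure R]_(t in `[0%R, (2 * pi)%R])
      s' (cline a b (cos t, sin t)))%E.
  move=> ca; have [y [v [ya yA vU cv]]] := minorant_sequence ca aA.
  rewrite -(@le_integral_cstB _ _ _ _ _ (2 * pi) C c) => //; first last.
  - by move=> t _; exact: sC.
  - exact: ms.
  - exact: ltW.
  - exact: lebesgue_measure_period.
  - rewrite leNgt; apply/negP => lt.
    have : \forall k \near \oo, (((C - c) * (2 * pi))%:E <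
        \int[@lebesgue_measure R]_(t in `[0%R, (2 * pi)%R])
          (C%:E - s' (cline (y k) b (cos t, sin t))))%E.
      apply: (@lt_fatou R _ (measurableTypeR R) (@lebesgue_measure R) _
        (fun k t => C%:E - s' (cline (y k) b (cos t, sin t))%R)%E
        (fun t => C%:E - s' (cline a b (cos t, sin t))%R)%E) => //.
      + by move=> k; exact: mCs.
      + by move=> k t _; rewrite sube_ge0 ?sC//= orbT.
      + exact: mCs.
      + by move=> t _; rewrite sube_ge0 ?sC//= orbT.
      (* Upper semicontinuity of [s'] at the point of the limit circle bounds the lower limit of C -
         s' from below. *)
      + move=> t _; rewrite leNgt; apply/negP => /ereal_lt_dense[l lf lg].
        move: lf; rewrite ltNge => /negP; apply; apply: limn_einf_ge.
        move: lg; rewrite lt_cstB => /usc_at_usc_reg near_pt.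
        have : cline (y k) b (cos t, sin t) @[k --> \oo] -->
            cline a b (cos t, sin t).
          apply: (cvg_comp (fun k => (y k, (cos t, sin t)))
            (fun z : Cn R N * (R * R) => cline z.1 b z.2) _
            (@cline_continuous R N b (a, (cos t, sin t)))).
          by apply: cvg_to_pair => //; exact: cvg_cst.
        move=> /(_ _ near_pt)[n _ h]; exists n => // k /h /= lk.
        by rewrite ltW// lt_cstB.
    move=> /filter_ex[k]; rewrite ltNge => /negP; apply.
    have Uvk := vU k; have [pvk _] := Uvk.
    apply: le_trans (circle_mean_cstB (C := C) pvk b0 (ltW C0) _ (ltW (cv k))).
      apply: ge0_le_integral => //.
      + by move=> t _; rewrite sube_ge0 ?sC//= orbT.
      + exact: mCs.
      + apply: emeasurable_funB; first exact: measurable_cst.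
        apply: measurable_circle => t.
        case: pvk => _ _ + _; apply.
        by have [] := AQ _ (yA k) _ (circle_in_cdisk t).
      + by move=> t _; exact: (leeB (lexx _) (vs' _ _ Uvk)).
    move=> x /(AQ _ (yA k))[Ox sx]; split => //.
    exact: le_trans (vs' _ _ Uvk) sx.
have Oa : O a by rewrite -(cline0 a b); apply: dO; rewrite /cdisk /= subr0; lra.
(* The inequality is trivial if s'(a) = -oo; for a finite value let the constant in [main] increase
   to it. *)
have := usc_reg_envelope_ltoo P Oa; case E : (s' a) => [t| |] // _; last first.
  by rewrite gt0_muleNy ?lte_fin// leNye.
rewrite -EFinM leNgt; apply/negP => /ereal_lt_dense[c Ic]; rewrite lte_fin => ct.
have ct' : ((c / (2 * pi))%:E < s' a)%E.
  by rewrite E lte_fin ltr_pdivrMr// mulrC.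
have := main _ ct'; rewrite mulrCA divff ?gt_eqF// mulr1.
by rewrite leNgt Ic.
Qed.

Lemma psh_usc_reg_envelope (P : statementP R) : psh O s'.
Proof.
apply: psh_of_unit_circle => //.
- exact: usc_reg_envelope_ltoo.
- by move=> x _; exact: usc_at_usc_reg.
- exact: usc_reg_envelope_circle_mean.
Qed.

End envelope.

Theorem theorem4p3 (R : realType) :
  statementP R ->
  forall (N : nat) (O : set (Cn R N)) (u : Cn R N -> \bar R),
    open O ->
    (forall x, O x -> (u x < +oo)%E) ->
    (forall a b : Cn R N, b != 0 ->
       subharmonic [set lam | O (cline a b lam)] (u \o cline a b)) ->
    psh O (psh_envelope O u).
Proof.
move=> P N O u oO uoo ul.
have pshr := psh_usc_reg_envelope oO uoo ul P.
suff -> : psh_envelope O u = usc_reg (psh_envelope O u) by [].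
apply/funext => z; apply/eqP; rewrite eq_le le_usc_reg /=.
(* The regularization belongs to the family whose supremum is the envelope, which gives equality at
   every point, also off [O]. *)
apply: ereal_sup_ubound; exists (usc_reg (psh_envelope O u)) => //; split => //.
by move=> x; exact: usc_reg_envelope_le.
Qed.
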